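(* Let $K$ be a field of characteristic $0$ and let $\eta\in K\setminus\{0\}$ not be a root of unity. Then the down-up algebra $A_\eta=A(1+\eta,-\eta,1)$ does not have property $(\diamond)$: there exists a finitely generated monolithic left $A_\eta$-module that is not artinian.
   Context: For $\alpha,\beta,\gamma\in K$, the down-up algebra $A(\alpha,\beta,\gamma)$ is the $K$-algebra generated by $d,u$ with relations $d^2u=\alpha dud+\beta ud^2+\gamma d$ and $du^2=\alpha udu+\beta u^2d+\gamma u$. A module $M$ is monolithic if the intersection of all nonzero submodules of $M$ is nonzero. A noetherian ring has property $(\diamond)$ if every finitely generated monolithic module over it is artinian. *)

(* Defs.v *)
From HB Require Import structures.
From mathcomp Require Import all_boot all_order all_algebra.
Set Implicit Arguments. Unset Strict Implicit. Unset Printing Implicit Defensive.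
Import GRing.Theory.
Local Open Scope ring_scope.

(* A left module over the down-up algebra A(alpha,beta,gamma) (the K-algebra
   generated by d,u subject to the two down-up relations) is, by the universal
   property of a presented algebra, a K-vector space M together with two
   K-linear endomorphisms d, u of M satisfying the defining relations. *)
Definition downup_rel (K : fieldType) (M : lmodType K)
    (alpha beta gamma : K) (d u : M -> M) : Prop :=
  forall x : M,
    d (d (u x)) = alpha *: d (u (d x)) + beta *: u (d (d x)) + gamma *: d x /\
    d (u (u x)) = alpha *: u (d (u x)) + beta *: u (u (d x)) + gamma *: u x.

Definition is_submodule (K : fieldType) (M : lmodType K) (d u : M -> M)
    (N : M -> Prop) : Prop :=
  [/\ N 0,
      (forall x y, N x -> N y -> N (x + y)),
      (forall (a : K) x, N x -> N (a *: x)),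
      (forall x, N x -> N (d x)) &
      (forall x, N x -> N (u x))].

Definition nonzero_set (K : fieldType) (M : lmodType K) (N : M -> Prop) : Prop :=
  exists2 x, N x & x <> 0.

Definition monolithic (K : fieldType) (M : lmodType K) (d u : M -> M) : Prop :=
  nonzero_set (fun x : M => forall N, is_submodule d u N -> nonzero_set N -> N x).

Definition fin_gen (K : fieldType) (M : lmodType K) (d u : M -> M) : Prop :=
  exists s : seq M, forall N, is_submodule d u N ->
    (forall x, x \in s -> N x) -> forall y, N y.

Definition artinian (K : fieldType) (M : lmodType K) (d u : M -> M) : Prop :=
  forall N : nat -> M -> Prop,
    (forall n, is_submodule d u (N n)) ->
    (forall n x, N n.+1 x -> N n x) ->
    exists n0, forall n, (n0 <= n)%N -> forall x, N n x <-> N n0 x.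

(* Main.v *)
(* The normal element z = du - ud - 1/(1 - eta) satisfies zu = eta uz and
   dz = eta zd. Let d act on K[[x]] as multiplication by x and u as
   (eta - 1)^-1 (f' + t (f(x/eta) - f(x)) / x), so that z acts up to a nonzero
   scalar as f(x) |-> f(x/eta) for t <> 0. If moreover u x^m is a nonzero
   multiple of x^(m-1) for every m > 0, then K[x] is a simple submodule. The
   module is the one generated by 1/(1-x). It consists of rational functions
   with poles among the powers of eta, so multiplying by powers of x - eta^j
   brings any nonzero element into K[x] \ {0}; hence it is monolithic. The
   submodules of functions with poles in {eta^j : j >= k} form a strictly
   decreasing chain, since z^k maps 1/(1-x) to a multiple of 1/(1 - x/eta^k). *)
Require Import Defs.
From HB Require Import structures.
From mathcomp Require Import all_boot all_order all_algebra.
From mathcomp Require Import boolp functions.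
From mathcomp Require Import zify ring.
Import GRing.Theory.
Local Open Scope ring_scope.

(** * The submodule generated by one vector, as a module in its own right *)

Section CyclicSubmodule.
Set Implicit Arguments. Unset Strict Implicit.
Variables (K : fieldType) (V : lmodType K) (d u : {linear V -> V}) (v : V).

Definition generated (x : V) : Prop :=
  forall N : V -> Prop, is_submodule d u N -> N v -> N x.

Lemma generated_is_submodule : is_submodule d u generated.
Proof.
split=> [N [] //|x y Gx Gy N sN Nv|a x Gx N sN Nv|x Gx N sN Nv|x Gx N sN Nv];
  case: (sN) => _ ND NZ Nd Nu.
- by apply: ND; [apply: Gx | apply: Gy].
- by apply: NZ; apply: Gx.
- by apply: Nd; apply: Gx.
- by apply: Nu; apply: Gx.
Qed.

(** Boolean-valued through classical logic, as the subtype instances below require. *)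
Definition cyclic_pred : {pred V} := fun x => `[< generated x >].

Lemma cyclic_predP x : reflect (generated x) (x \in cyclic_pred).
Proof. exact: asboolP. Qed.

Fact cyclic_submod_closed : submod_closed cyclic_pred.
Proof.
have [G0 GD GZ _ _] := generated_is_submodule; split=> [|a x y].
  exact/cyclic_predP.
by move=> /cyclic_predP Gx /cyclic_predP Gy; apply/cyclic_predP; apply: GD => //; apply: GZ.
Qed.

HB.instance Definition _ :=
  GRing.isSubmodClosed.Build K V cyclic_pred cyclic_submod_closed.

Record cyclic_submodule := CyclicSubmodule {
  cyclic_val : V; _ : cyclic_val \in cyclic_pred }.

HB.instance Definition _ := [isSub for cyclic_val].
HB.instance Definition _ := [Choice of cyclic_submodule by <:].
HB.instance Definition _ := [SubChoice_isSubLmodule of cyclic_submodule by <:].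

Fact cyclic_d_subproof (x : cyclic_submodule) : d (val x) \in cyclic_pred.
Proof.
have [_ _ _ Gd _] := generated_is_submodule.
by apply/cyclic_predP; apply: Gd; apply/cyclic_predP; case: x.
Qed.

Fact cyclic_u_subproof (x : cyclic_submodule) : u (val x) \in cyclic_pred.
Proof.
have [_ _ _ _ Gu] := generated_is_submodule.
by apply/cyclic_predP; apply: Gu; apply/cyclic_predP; case: x.
Qed.

Definition cyclic_d x := CyclicSubmodule (cyclic_d_subproof x).
Definition cyclic_u x := CyclicSubmodule (cyclic_u_subproof x).

Fact cyclic_d_linear : linear cyclic_d.
Proof. by move=> a x y; apply: val_inj; rewrite /= !linearP. Qed.

Fact cyclic_u_linear : linear cyclic_u.
Proof. by move=> a x y; apply: val_inj; rewrite /= !linearP. Qed.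

HB.instance Definition _ := GRing.isLinear.Build K _ _ _ cyclic_d cyclic_d_linear.
HB.instance Definition _ := GRing.isLinear.Build K _ _ _ cyclic_u cyclic_u_linear.

Lemma generator_in_cyclic : v \in cyclic_pred.
Proof. by apply/cyclic_predP. Qed.

Definition cyclic_image (N : cyclic_submodule -> Prop) (x : V) : Prop :=
  exists xP : x \in cyclic_pred, N (CyclicSubmodule xP).

Lemma cyclic_image_val N x : cyclic_image N (val x) <-> N x.
Proof.
case: x => x xP; split=> [[xP' Nx]|Nx]; last by exists xP.
by rewrite (bool_irrelevance xP xP').
Qed.

Lemma cyclic_image_is_submodule N :
  is_submodule cyclic_d cyclic_u N -> is_submodule d u (cyclic_image N).
Proof.
have imN x : N x -> cyclic_image N (val x) by move=> /cyclic_image_val.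
move=> [N0 ND NZ Nd Nu]; split.
- by rewrite -(raddf0 (val : cyclic_submodule -> V)); apply: imN.
- move=> x z [xP Nx] [zP Nz].
  by have := imN _ (ND _ _ Nx Nz); rewrite raddfD.
- by move=> a x [xP Nx]; have := imN _ (NZ a _ Nx); rewrite linearZ.
- by move=> x [xP Nx]; apply: (imN _ (Nd _ Nx)).
- by move=> x [xP Nx]; apply: (imN _ (Nu _ Nx)).
Qed.

Lemma cyclic_preimage_is_submodule (N : V -> Prop) :
  is_submodule d u N -> is_submodule cyclic_d cyclic_u (fun x => N (val x)).
Proof.
move=> [N0 ND NZ Nd Nu]; split=> [|x y Nx Ny|a x Nx|x Nx|x Nx].
- by rewrite raddf0.
- by rewrite raddfD; apply: ND.
- by rewrite linearZ; apply: NZ.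
- exact: Nd.
- exact: Nu.
Qed.

(** Pushed forward to [V], a submodule containing the generator contains [v], hence everything in
    [generated]. *)
Lemma cyclic_fin_gen : fin_gen cyclic_d cyclic_u.
Proof.
exists [:: CyclicSubmodule generator_in_cyclic] => N sN Nv y.
have Gy : generated (val y) by apply/cyclic_predP; case: y.
apply/cyclic_image_val/(Gy (cyclic_image N)); first exact: cyclic_image_is_submodule.
by exists generator_in_cyclic; apply: Nv; rewrite mem_head.
Qed.

Lemma cyclic_downup_rel alpha beta gamma :
  downup_rel alpha beta gamma d u -> downup_rel alpha beta gamma cyclic_d cyclic_u.
Proof.
move=> rel x; have [r1 r2] := rel (val x).
by split; apply: val_inj; rewrite !linearD !linearZ.
Qed.

End CyclicSubmodule.

(** * Choice of the parameter t in characteristic 0 *)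

Section Weights.
Set Implicit Arguments. Unset Strict Implicit.
Variables (K : fieldType).
Hypothesis (charK0 : [pchar K] =i pred0).

Lemma pchar0_natr_inj : injective (fun n : nat => n%:R : K).
Proof.
have /pcharf0P natr0 := charK0.
move=> a b /= eqab; wlog le_ba : a b eqab / (b <= a)%N.
  by move=> W; case/orP: (leq_total b a) => /W; [apply|move/(_ (esym eqab))].
apply/eqP; rewrite eqn_leq le_ba andbT -subn_eq0 -natr0 natrB //.
by rewrite eqab subrr.
Qed.

(* t = 1 works unless zeta^(q+1) = -q for some q >= 2. In that case t = 1/q
   works: otherwise zeta^m = 1 - mq for some m, and comparing the two values of
   zeta^(2m(q+1)) gives q^(2m) = (mq-1)^(2(q+1)), impossible for coprime bases. *)
Lemma exists_regular_weight (zeta : K) :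
    zeta != 0 -> (forall n, (0 < n)%N -> zeta ^+ n != 1) ->
  exists2 t : K, t != 0 & forall m, (0 < m)%N -> m%:R + t * (zeta ^+ m - 1) != 0.
Proof.
move=> z0 zn1; have /pcharf0P natr0 := charK0.
have [ok|] := pselect (forall m, (0 < m)%N -> m%:R + (zeta ^+ m - 1) != 0).
  by exists 1 => [|m m0]; rewrite ?oner_eq0 // mul1r ok.
move=> /existsNP [m0 /not_implyP [m0_gt0 /negP]]; rewrite negbK => /eqP E.
(* Exponent 1 would force zeta = 0, and exponent 2 would force zeta^2 = -1, hence zeta^4 = 1. *)
case: m0 m0_gt0 E => // -[|k] _.
  by move=> E; case/eqP: z0; rewrite -[RHS]E expr1; ring.
case: k => [|k].
  move=> E; have z2 : zeta ^+ 2 = -1 by apply/eqP; rewrite -subr_eq0 -E; apply/eqP; ring.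
  by have := zn1 4%N isT; rewrite (exprM _ 2 2) z2 sqrrN expr1n eqxx.
set q := k.+2 => E.
have q0 : (q%:R : K) != 0 by rewrite natr0.
have zq : zeta ^+ q.+1 = - q%:R.
  by apply/eqP; rewrite -subr_eq0 -E; apply/eqP; rewrite -[q.+1]addn1 natrD; ring.
exists q%:R^-1 => [|m m_gt0]; first by rewrite invr_eq0.
apply/eqP => F.
have mq0 : (0 < m * q)%N by rewrite muln_gt0 m_gt0.
have zm : zeta ^+ m = - (m * q).-1%:R.
  have : q%:R * (m%:R + q%:R^-1 * (zeta ^+ m - 1)) = 0 by rewrite F mulr0.
  rewrite mulrDr mulrA divff // mul1r -natrM mulnC -{1}(prednK mq0) -addn1 natrD => H.
  by apply/eqP; rewrite -subr_eq0 -H; apply/eqP; ring.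
have : zeta ^+ (q.+1 * (m * 2)) = zeta ^+ (m * (q.+1 * 2)) by congr (_ ^+ _); lia.
(* The exponents 2m and 2(q+1) are even, so the signs disappear and the equation descends to natural
   numbers. *)
rewrite [LHS]exprM [RHS]exprM zq zm !(mulnC _ 2%N) !(exprM _ 2) !sqrrN -!exprM -!natrX.
move=> /pchar0_natr_inj eqX.
have cop : coprime q (m * q).-1.
  have := coprimenS (m * q).-1; rewrite prednK // coprimeMr => /andP[_].
  by rewrite coprime_sym.
(* A number coprime to itself is 1, whereas q >= 2 and 2m > 0. *)
have : coprime (q ^ (2 * m)) (q ^ (2 * m)).
  by rewrite {2}eqX coprimeXl // coprimeXr.
by rewrite /coprime gcdnn -(expn0 q) eqn_exp2l // muln_eq0 /= -leqn0 leqNgt m_gt0.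
Qed.

End Weights.

(** * The action on power series, and rational functions with poles at powers of eta *)

Section PowerSeries.
Set Implicit Arguments. Unset Strict Implicit.
Variables (K : fieldType) (eta t : K).
Hypotheses (eta_neq0 : eta != 0)
  (eta_not_root_of_unity : forall n, (0 < n)%N -> eta ^+ n != 1)
  (t_neq0 : t != 0)
  (t_regular : forall m, (0 < m)%N -> m%:R + t * (eta^-1 ^+ m - 1) != 0).

Local Notation series := (nat -> K^o).
Local Notation zeta := (eta^-1).

(* A sequence f stands for the power series sum_n f n x^n. *)
Definition shift (f : series) : series := fun n => if n is m.+1 then f m else 0.
Definition weight (m : nat) : K := (m%:R + t * (zeta ^+ m - 1)) / (eta - 1).
Definition lower (f : series) : series := fun n => weight n.+1 * f n.+1.
Definition euler (f : series) : series := fun n => n%:R * f n.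
Definition dilate (f : series) : series := fun n => zeta ^+ n * f n.

Fact shift_linear : linear shift.
Proof. by move=> a f g; apply/funext => -[|n] //=; rewrite !fctE scaler0 addr0. Qed.

Fact lower_linear : linear lower.
Proof. by move=> a f g; apply/funext => n; rewrite /lower !fctE /GRing.scale /=; ring. Qed.

HB.instance Definition _ := GRing.isLinear.Build K _ _ _ shift shift_linear.
HB.instance Definition _ := GRing.isLinear.Build K _ _ _ lower lower_linear.

Lemma eta_sub1_neq0 : eta - 1 != 0.
Proof. by rewrite subr_eq0 -(expr1 eta) eta_not_root_of_unity. Qed.

Lemma eta_expI : injective (fun n => eta ^+ n).
Proof.
move=> a b /= eqab; wlog le_ab : a b eqab / (a <= b)%N.
  by move=> W; case/orP: (leq_total a b) => /W; [apply|move/(_ (esym eqab))].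
case: (posnP (b - a)) => [/eqP|/eta_not_root_of_unity/negP[]].
  by rewrite subn_eq0 => le_ba; apply/eqP; rewrite eqn_leq le_ab.
apply/eqP/(mulfI (expf_neq0 a eta_neq0)).
by rewrite -exprD subnKC // mulr1.
Qed.

Lemma weight0 : weight 0 = 0.
Proof. by rewrite /weight expr0 subrr mulr0 addr0 mul0r. Qed.

Lemma weightS_neq0 m : weight m.+1 != 0.
Proof. by rewrite mulf_neq0 ?invr_eq0 ?eta_sub1_neq0 ?t_regular. Qed.

(** The recurrence w_m - (1 + eta) w_(m+1) + eta w_(m+2) has characteristic roots 1 and 1/eta, so it
    kills constants and zeta^m. On w_m = m it gives eta - 1, which the denominator of [weight]
    normalises to 1. *)
Lemma weight_rec m : weight m = (1 + eta) * weight m.+1 - eta * weight m.+2 + 1.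
Proof.
have e1 := eta_sub1_neq0.
by rewrite /weight !exprS -(addn2 m) -(addn1 m) !natrD; field; rewrite e1 eta_neq0.
Qed.

Lemma lowerE f n : lower f n = weight n.+1 * f n.+1.
Proof. by []. Qed.

Lemma shift_lower f n : shift (lower f) n = weight n * f n.
Proof. by case: n => [|n] //=; rewrite weight0 mul0r. Qed.

(** Coefficient by coefficient, each relation is a multiple of [weight_rec]. *)
Lemma series_downup_rel : downup_rel (1 + eta) (- eta) 1 shift lower.
Proof.
move=> f; split; apply/funext => n; rewrite !fctE /GRing.scale /=.
  case: n => [|n] /=; first by rewrite !lowerE /=; ring.
  by rewrite shift_lower !lowerE /= (weight_rec n); ring.
by rewrite !(shift_lower, lowerE) (weight_rec n) /=; ring.
Qed.

Definition finite_support (f : series) := exists m, forall n, (m <= n)%N -> f n = 0.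

Lemma finite_supportD f g :
  finite_support f -> finite_support g -> finite_support (f + g).
Proof.
move=> [a fa] [b gb]; exists (maxn a b) => n.
by rewrite geq_max fctE => /andP[/fa-> /gb->]; rewrite addr0.
Qed.

Lemma finite_support_mul (c : nat -> K) f :
  finite_support f -> finite_support (fun n => c n * f n : K^o).
Proof. by move=> [a fa]; exists a => n /fa->; rewrite mulr0. Qed.

Lemma finite_supportZ (c : K) f : finite_support f -> finite_support (c *: f).
Proof. exact: (finite_support_mul (fun=> c)). Qed.

Lemma finite_support_shift f : finite_support f -> finite_support (shift f).
Proof. by move=> [a fa]; exists a.+1 => -[|n] //= /fa. Qed.

(* Multiplication by x - eta^j. *)
Definition cut (j : nat) (f : series) : series := shift f - eta ^+ j *: f.

Lemma cutE j f : cut j f = shift f + (- eta ^+ j) *: f.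
Proof. by rewrite /cut scaleNr. Qed.

Lemma cutD j f g : cut j (f + g) = cut j f + cut j g.
Proof. by rewrite /cut linearD scalerDr opprD addrACA. Qed.

Lemma cutZ j (c : K) f : cut j (c *: f) = c *: cut j f.
Proof. by rewrite /cut linearZ /= scalerBr !scalerA mulrC. Qed.

Lemma cut_shift j f : cut j (shift f) = shift (cut j f).
Proof. by rewrite !cutE [RHS]linearD [in RHS]linearZ. Qed.

Lemma cutC i j f : cut i (cut j f) = cut j (cut i f).
Proof. by rewrite [cut j f]cutE cutD cutZ cut_shift -cutE. Qed.

Lemma finite_support_cut j f : finite_support f -> finite_support (cut j f).
Proof.
move=> fsf; rewrite /cut -scaleNr.
exact: finite_supportD (finite_support_shift fsf) (finite_supportZ _ fsf).
Qed.

(* poles_from k f: f is a rational function whose poles are all of the form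
   eta^j with j >= k. *)
Inductive poles_from (k : nat) : series -> Prop :=
| PolesFS f : finite_support f -> poles_from k f
| PolesCut j f : (k <= j)%N -> poles_from k (cut j f) -> poles_from k f.

Lemma poles_from_shift k f : poles_from k f -> poles_from k (shift f).
Proof.
elim=> [g fsg|j g kj _ IH]; first exact/PolesFS/finite_support_shift.
by apply: (PolesCut kj); rewrite cut_shift.
Qed.

(** Serves [poles_from_lower]: [lower] involves a division by x, so its closed formula is stated
    after multiplying by x. *)
Lemma poles_from_unshift k f : poles_from k (shift f) -> poles_from k f.
Proof.
move: {-1}(shift f) (erefl (shift f)) => g E P.
elim: P f E => {g} [g [m gm]|j g kj _ IH] f E.
  by apply: PolesFS; exists m => n mn; rewrite -[f n]/(shift f n.+1) E gm // leqW.
by apply: (PolesCut kj); apply: IH; rewrite -E cut_shift.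
Qed.

Lemma poles_fromZ k (c : K) f : poles_from k f -> poles_from k (c *: f).
Proof.
elim=> [g fsg|j g kj _ IH]; first exact/PolesFS/finite_supportZ.
by apply: (PolesCut kj); rewrite cutZ.
Qed.

Lemma poles_from_cut k i f : poles_from k f -> poles_from k (cut i f).
Proof.
elim=> [g fsg|j g kj _ IH]; first exact/PolesFS/finite_support_cut.
by apply: (PolesCut kj); rewrite cutC.
Qed.

(** A factor clearing a pole of one summand also multiplies the other, hence an induction on f
    followed by one on g. *)
Lemma poles_fromD k f g : poles_from k f -> poles_from k g -> poles_from k (f + g).
Proof.
move=> Pf; elim: Pf g => [{}f fsf g Pg|j {}f kj _ IH g Pg].
  elim: Pg f fsf => [{}g fsg f fsf|j {}g kj _ IH f fsf].
    exact/PolesFS/finite_supportD.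
  by apply: (PolesCut kj); rewrite cutD; apply/IH/finite_support_cut.
by apply: (PolesCut kj); rewrite cutD; apply/IH/poles_from_cut.
Qed.

Lemma poles_from_euler k f : poles_from k f -> poles_from k (euler f).
Proof.
elim=> [g fsg|j g kj Pg IH]; first exact/PolesFS/finite_support_mul.
apply: (PolesCut kj).
(* Product rule for x d/dx applied to (x - eta^j) g. *)
suff -> : cut j (euler g) = euler (cut j g) + (-1) *: shift g.
  by apply/poles_fromD/poles_fromZ/poles_from_shift/(PolesCut kj).
apply/funext => -[|n]; rewrite /cut /euler !fctE /GRing.scale /=; first by ring.
by rewrite -[n.+1]addn1 natrD; ring.
Qed.

Lemma poles_from_dilate k f : poles_from k f -> poles_from k (dilate f).
Proof.
elim=> [g fsg|j g kj Pg IH]; first exact/PolesFS/finite_support_mul.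
(* Substituting x/eta moves a pole from eta^j to eta^(j+1). *)
apply: (@PolesCut _ j.+1); first exact: leqW.
suff -> : cut j.+1 (dilate g) = eta *: dilate (cut j g) by apply: poles_fromZ.
apply/funext => -[|n]; rewrite /cut /dilate !fctE /GRing.scale /= !exprS; first by ring.
by field; rewrite eta_neq0.
Qed.

Lemma poles_from_lower k f : poles_from k f -> poles_from k (lower f).
Proof.
move=> Pf; apply: poles_from_unshift.
suff -> : shift (lower f) =
    (eta - 1)^-1 *: (euler f + t *: (dilate f + (-1) *: f)).
  apply/poles_fromZ/poles_fromD; first exact: poles_from_euler.
  apply/poles_fromZ/poles_fromD; first exact: poles_from_dilate.
  exact: poles_fromZ.
apply/funext => -[|n]; rewrite /euler /dilate !fctE /GRing.scale /=.
  by rewrite expr0; ring.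
by rewrite /lower /weight; ring.
Qed.

Lemma poles_from_is_submodule k : is_submodule shift lower (poles_from k).
Proof.
split.
- by apply: PolesFS; exists 0.
- exact: poles_fromD.
- exact: poles_fromZ.
- exact: poles_from_shift.
- exact: poles_from_lower.
Qed.

Lemma poles_from_mono k l f : (l <= k)%N -> poles_from k f -> poles_from l f.
Proof.
move=> lk; elim=> [g fsg|j g kj _ IH]; first exact: PolesFS.
by apply: (PolesCut _ IH); apply: leq_trans kj.
Qed.

(** The factor x - eta^j has nonzero constant term, so if the product is 0, the coefficients of f
    vanish one after another. *)
Lemma cut_neq0 j f : f <> 0 -> cut j f <> 0.
Proof.
move=> f0 cf0; apply: f0.
have e0 := expf_neq0 j eta_neq0.
suff H n : f n = 0 by apply/funext => n; rewrite H.
elim: n => [|n IH].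
  have /eqP := congr1 (@^~ 0%N) cf0.
  by rewrite /cut !fctE /GRing.scale /= sub0r oppr_eq0 mulf_eq0 (negbTE e0) => /eqP.
have /eqP := congr1 (@^~ n.+1) cf0.
by rewrite /cut !fctE /GRing.scale /= IH sub0r oppr_eq0 mulf_eq0 (negbTE e0) => /eqP.
Qed.

Definition one_series : series := fun n => (n == 0%N)%:R.

(** Cuts stay inside [N] and turn f into a nonzero polynomial. Then [lower] reduces the degree, the
    leading term surviving by [weightS_neq0], until a nonzero constant remains. *)
Lemma one_series_in_submodule N f k :
  is_submodule shift lower N -> poles_from k f -> N f -> f <> 0 -> N one_series.
Proof.
move=> [N0 ND NZ Nd Nu]; elim=> {f} [f [m fm]|j f kj _ IH] Nf f0; last first.
  apply: IH; last exact: cut_neq0.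
  by rewrite /cut -scaleNr; apply: ND; [apply: Nd | apply: NZ].
elim: m f fm Nf f0 => [|m IH] f fm Nf f0.
  by case: f0; apply/funext => n; rewrite fm.
have [fm0|fm0] := eqVneq (f m) 0.
  apply: (IH f) => // n; rewrite leq_eqVlt => /orP[/eqP<- //|]; exact: fm.
case: m => [|m] in IH fm fm0 *.
  suff -> : one_series = (f 0)^-1 *: f by apply: NZ.
  apply/funext => -[|n]; rewrite /one_series !fctE /GRing.scale /=.
    by rewrite mulVf.
  by rewrite (fm n.+1) // mulr0.
apply: (IH (lower f)); [| exact: Nu |].
  by move=> n mn; rewrite /lower fm ?mulr0.
move/(congr1 (@^~ m)) => /= /eqP.
by rewrite /lower mulf_eq0 (negbTE (weightS_neq0 m)) (negbTE fm0).
Qed.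

(* The expansion of 1 / (1 - x / eta^k). *)
Definition geometric (k : nat) : series := fun n => zeta ^+ (k * n).

Lemma poles_from_geometric k : poles_from k (geometric k).
Proof.
apply: (PolesCut (leqnn k)); apply: PolesFS; exists 1%N => -[|n] // _.
rewrite /cut /geometric !fctE /GRing.scale /= mulnS exprD mulrA -exprMn.
by rewrite divff // expr1n mul1r subrr.
Qed.

Lemma not_poles_from_geometric k : ~ poles_from k.+1 (geometric k).
Proof.
(* Strengthened for the induction to agreement from some index on. A cut multiplies c by eta^k -
   eta^j, which is nonzero as k < j. *)
suff H f : poles_from k.+1 f ->
    forall (c : K) m, (forall n, (m <= n)%N -> f n = c * geometric k n) -> c = 0.
  move/H => /(_ 1 0%N) => /(_ (fun n _ => esym (mul1r _)))/eqP.
  by rewrite oner_eq0.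
have z0 i : zeta ^+ i != 0 by rewrite expf_neq0 // invr_eq0.
elim=> [g [a ga]|j g kj _ IH] c m gm.
  have := gm (maxn a m) (leq_maxr _ _); rewrite ga ?leq_maxl // => /esym/eqP.
  by rewrite mulf_eq0 /geometric (negbTE (z0 _)) orbF => /eqP.
have /eqP : c * (eta ^+ k - eta ^+ j) = 0.
  (* A cut reads the preceding coefficient, hence the bound [m.+1]. *)
  apply: (IH _ m.+1) => -[//|n]; rewrite ltnS => mn.
  rewrite /cut !fctE /GRing.scale /= !gm ?leqW // /geometric mulnS exprD !exprVn.
  by field; rewrite !expf_neq0.
rewrite mulf_eq0 subr_eq0 => /orP[/eqP //|/eqP/eta_expI kj'].
by rewrite kj' ltnn in kj.
Qed.

(* dilate is an affine function of du - ud. *)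
Lemma submodule_dilate N f : is_submodule shift lower N -> N f -> N (dilate f).
Proof.
move=> [N0 ND NZ Nd Nu] Nf.
have e1 := eta_sub1_neq0.
(* Chosen so that weight n - weight (n+1) + 1/(eta - 1) = c zeta^n. *)
pose c := t * (1 - zeta) / (eta - 1).
have c0 : c != 0.
  rewrite !mulf_neq0 ?invr_eq0 //.
  by rewrite subr_eq0 eq_sym invr_eq1 -subr_eq0.
suff -> : dilate f = c^-1 *: (shift (lower f) + ((-1) *: lower (shift f)
    + (eta - 1)^-1 *: f)).
  apply/NZ/ND; first exact/Nd/Nu.
  by apply: ND; apply: NZ => //; apply/Nu/Nd.
apply/funext => n; apply: (mulfI c0).
rewrite /dilate !fctE /GRing.scale /= mulVKf //.
have -> : shift (lower f) n = weight n * f n.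
  by case: n => //=; rewrite weight0 mul0r.
by rewrite /lower /= /weight /c -[n.+1]addn1 natrD exprD expr1; field; rewrite e1 eta_neq0.
Qed.

Lemma submodule_geometric N k :
  is_submodule shift lower N -> N (geometric 0) -> N (geometric k).
Proof.
move=> sN N0; elim: k => [//|k /(submodule_dilate sN)].
suff -> : geometric k.+1 = dilate (geometric k) by [].
by apply/funext => n; rewrite /dilate /geometric mulSn exprD.
Qed.

End PowerSeries.

Theorem theorem4p2 (K : fieldType) (charK0 : [pchar K] =i pred0)
    (eta : K) (eta_neq0 : eta != 0)
    (eta_not_root_of_unity : forall n : nat, (0 < n)%N -> eta ^+ n != 1) :
  exists (M : lmodType K) (d u : {linear M -> M}),
    [/\ downup_rel (1 + eta) (- eta) 1 d u,
        fin_gen d u,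
        monolithic d u &
        ~ artinian d u].
Proof.
have zeta_neq0 : eta^-1 != 0 by rewrite invr_eq0.
have zeta_nru n : (0 < n)%N -> eta^-1 ^+ n != 1.
  by move=> n0; rewrite exprVn invr_eq1 eta_not_root_of_unity.
have [t t_neq0 t_reg] := exists_regular_weight charK0 zeta_neq0 zeta_nru.
pose v := geometric eta 0.
pose D : {linear _ -> _} := @shift K; pose U : {linear _ -> _} := lower eta t.
exists (cyclic_submodule D U v), (@cyclic_d _ _ D U v), (@cyclic_u _ _ D U v).
have sG := generated_is_submodule D U v.
have poles_val (x : cyclic_submodule D U v) : poles_from eta 0 (val x).
  have /cyclic_predP : val x \in cyclic_pred D U v by case: x.
  apply; first exact: poles_from_is_submodule.
  exact: poles_from_geometric.
have geoP k : geometric eta k \in cyclic_pred D U v.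
  apply/cyclic_predP => N sN Nv; exact: (submodule_geometric (t := t)).
(* The constant 1 will witness monolithicity; it is reached from the nonzero generator 1/(1-x). *)
have oneP : one_series K \in cyclic_pred D U v.
  apply/cyclic_predP.
  apply: (@one_series_in_submodule _ eta t _ _ _ _ v 0 sG) => //.
    exact: poles_from_geometric.
  by move/(congr1 (@^~ 0%N))/eqP; rewrite /v /geometric mul0n oner_eq0.
split.
- exact/cyclic_downup_rel/series_downup_rel.
- exact: cyclic_fin_gen.
- exists (CyclicSubmodule oneP) => [N sN [x Nx x0]|]; last first.
    by move/(congr1 val)/(congr1 (@^~ 0%N))/eqP; rewrite /= oner_eq0.
  apply/cyclic_image_val; have sN' := cyclic_image_is_submodule sN.
  apply: (one_series_in_submodule eta_neq0 _ t_reg sN' (poles_val x)) => //.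
    exact/cyclic_image_val.
  by move=> vx0; apply: x0; apply: val_inj; rewrite raddf0.
- pose N k (x : cyclic_submodule D U v) := poles_from eta k (val x).
  move=> /(_ N) [k|k x|k0 /(_ k0.+1 (leqnSn _)) stab].
  + exact/cyclic_preimage_is_submodule/poles_from_is_submodule.
  + exact: poles_from_mono.
  (* The function 1/(1 - x/eta^k0) lies in term k0 of the chain; stability would put it in term k0 +
     1. *)
  + apply: (not_poles_from_geometric eta_neq0 eta_not_root_of_unity (k := k0)).
    have [_] := stab (CyclicSubmodule (geoP k0)); apply.
    exact: poles_from_geometric.
Qed.
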